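(* Let $h>0$, $0<\alpha<1$, $1\leq p\leq\infty$, let $j_0<j_1$ be integers and let $u,v\in\ell^p(\mathbb{Z}_h)$. (i) Let $u$ be a solution of $(\delta_{\rm right})^{\alpha}u=f$ in $[j_0,j_1)$, $u=0$ in $[j_1,\infty)$. If $f\geq 0$ in $[j_0,j_1)$, then $u\geq 0$ in $[j_0,\infty)$. (ii) If $(\delta_{\rm right})^{\alpha}u\leq 0$ in $[j_0,j_1)$ and $u\leq 0$ in $[j_1,\infty)$, then $\sup_{j\geq j_0}u(jh)=\sup_{j\geq j_1}u(jh)$. (iii) If $(\delta_{\rm right})^{\alpha}u\geq 0$ in $[j_0,j_1)$ and $u\geq 0$ in $[j_1,\infty)$, then $\inf_{j\geq j_0}u(jh)=\inf_{j\geq j_1}u(jh)$. (iv) If $(\delta_{\rm right})^{\alpha}u\geq(\delta_{\rm right})^{\alpha}v$ in $[j_0,j_1)$ and $u\geq v$ in $[j_1,\infty)$, then $u\geq v$ in $[j_0,\infty)$. In particular, there is uniqueness (of the values on $[j_0,\infty)$, among functions in $\ell^p(\mathbb{Z}_h)$) for the Dirichlet problem $(\delta_{\rm right})^{\alpha}u=f$ in $[j_0,j_1)$, $u=g$ in $[j_1,\infty)$.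
   Context: For $h>0$, $\mathbb{Z}_h=\{jh: j\in\mathbb{Z}\}$, and $\ell^p(\mathbb{Z}_h)$ is the space of functions $u:\mathbb{Z}_h\to\mathbb{R}$ that are $p$-summable (bounded if $p=\infty$). A relation said to hold ''in $[j_0,j_1)$'' (resp. ''in $[j_1,\infty)$'') is meant to hold at all points $jh$ with $j$ an integer, $j_0\leq j<j_1$ (resp. $j\geq j_1$). The discrete derivative from the right is $\delta_{\rm right}u(nh)=\frac{u(nh)-u((n+1)h)}{h}$. For $0<\alpha<1$ its fractional power is $$(\delta_{\rm right})^{\alpha}u(nh)=\frac{1}{\Gamma(-\alpha)}\int_0^\infty\Big(\sum_{j=0}^\infty e^{-t/h}\frac{(t/h)^j}{j!}u((n+j)h)-u(nh)\Big)\frac{dt}{t^{1+\alpha}},$$ equivalently $$(\delta_{\rm right})^{\alpha}u(nh)=\frac{1}{h^{\alpha}}\sum_{j=0}^{\infty}\Lambda^\alpha(j)\,\big(u((n+j)h)-u(nh)\big)=\frac{1}{h^{\alpha}}\sum_{j=0}^{\infty}\Lambda^\alpha(j)\,u((n+j)h),$$ where $\Lambda^\alpha(m)=\binom{-\alpha-1+m}{m}=(-1)^m\binom{\alpha}{m}$, $m\in\mathbb{N}_0$. *)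

(* Defs.v *)
From HB Require Import structures.
From mathcomp Require Import all_boot all_order all_algebra.
From mathcomp Require Import all_classical all_reals all_analysis.

Set Implicit Arguments.
Unset Strict Implicit.
Unset Printing Implicit Defensive.

Import Order.TTheory GRing.Theory Num.Theory.
Import numFieldNormedType.Exports.

Local Open Scope classical_set_scope.
Local Open Scope ring_scope.

Section Gamma.
Context {R : realType}.

Definition euler_gamma (s : R) : R :=
  \int[lebesgue_measure]_(t in `]0, +oo[) (t `^ (s - 1) * expR (- t)).

(* For s <= 0 this is the continuation
     Gamma s = Gamma (s + n) / (s (s + 1) ... (s + n - 1)),
   n being the least integer with s + n > 0; at the poles 0, -1, -2, ... the
   value is a meaningless 0. *)
Definition Gamma (s : R) : R :=
  if 0 < s then euler_gamma s
  else let n := (Num.truncn (- s)).+1 in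
       euler_gamma (s + n%:R) / \prod_(k < n) (s + k%:R).

End Gamma.

Section Mesh.
Context {R : realType}.

Definition mesh (h : R) : set R := range (fun j : int => j%:~R * h).

Definition node (h : R) (j : int) : mesh h :=
  SigSub (mem_set (imageT (fun j : int => j%:~R * h) j)).

Definition ell (h : R) (p : \bar R) (u : mesh h -> R) : Prop :=
  match p with
  | r%:E => summable [set: mesh h] (fun x => (`|u x| `^ r)%:E)
  | +oo%E => exists M : R, forall x, `|u x| <= M
  | -oo%E => False
  end.

(* With S the shift S u(nh) = u((n+1)h), delta_right = (1 - S) / h, hence
   exp (- t delta_right) = exp (- t / h) exp ((t / h) S). This is the value
   of exp (- t delta_right) u at nh. *)
Definition right_semigroup (h t : R) (u : mesh h -> R) (n : int) : R :=
  limn (series (fun j : nat =>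
    expR (- (t / h)) * ((t / h) ^+ j / j`!%:R) * u (node h (n + j%:Z)))).

(* The value of (delta_right)^alpha u at nh, for 0 < alpha < 1. *)
Definition frac_delta_right (h alpha : R) (u : mesh h -> R) (n : int) : R :=
  (Gamma (- alpha))^-1 *
  \int[lebesgue_measure]_(t in `]0, +oo[)
     ((right_semigroup t u n - u (node h n)) / t `^ (1 + alpha)).

(* Only the values of f at jh with j0 <= j < j1, and those of g at jh with
   j1 <= j, matter. *)
Definition dirichlet_solution (h alpha : R) (j0 j1 : int)
    (f g u : mesh h -> R) : Prop :=
  (forall j : int, j0 <= j < j1 -> frac_delta_right alpha u j = f (node h j)) /\
  (forall j : int, j1 <= j -> u (node h j) = g (node h j)).

End Mesh.

(* Main.v *)
(** The semigroup [exp (- t delta_right)] replaces [u (nh)] by the average of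
the [u ((n + j) h)] under the Poisson law of parameter [t / h] in [j]. Hence,
where [u - v] attains over [n, oo[ a minimum at [n] that is not attained at
some later point, the integrand of [frac_delta_right] is strictly larger for [u]
than for [v] at every [t > 0]. As [Gamma (- alpha) < 0], this gives
[delta^alpha u < delta^alpha v] at [n]. A negative minimum of [u - v] over
[j0, j1[ is such a point when [v <= u] on [j1, oo[, so that
[delta^alpha v <= delta^alpha u] on [j0, j1[ excludes it. Constants being
annihilated by [delta^alpha], (i)-(iii) are comparisons of [u] with constants.
*)

Require Import Defs.
From HB Require Import structures.
From mathcomp Require Import all_boot all_order all_algebra.
From mathcomp Require Import all_classical all_reals all_analysis.
From mathcomp Require Import measurable_realfun ring lra.

Set Implicit Arguments.
Unset Strict Implicit.
Unset Printing Implicit Defensive.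

Import Order.TTheory GRing.Theory Num.Theory.
Import numFieldNormedType.Exports.

Local Open Scope classical_set_scope.
Local Open Scope ring_scope.

(** * Averages of bounded sequences under the Poisson law *)

Section PoissonMean.
Context {R : realType}.
Implicit Types (x M c : R) (w z : nat -> R).

Definition poisson_weight x (j : nat) : R := expR (- x) * (x ^+ j / j`!%:R).

(** With [x = t / h] and [w j = u ((n + j) h)] this is [right_semigroup t u n] by conversion; what
    follows depends only on the sequence [w]. *)
Definition poisson_mean x w : R :=
  limn (series (fun j => poisson_weight x j * w j)).

Lemma poisson_weight_ge0 x j : 0 <= x -> 0 <= poisson_weight x j.
Proof. by move=> x0; rewrite mulr_ge0 ?expR_ge0// divr_ge0// exprn_ge0. Qed.

Lemma poisson_weight_gt0 x j : 0 < x -> 0 < poisson_weight x j.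
Proof.
by move=> x0; rewrite mulr_gt0 ?expR_gt0// divr_gt0 ?exprn_gt0// ltr0n fact_gt0.
Qed.

Lemma is_cvg_poisson_mean M x w : 0 <= x -> (forall j, `|w j| <= M) ->
  cvgn (series (fun j => poisson_weight x j * w j)).
Proof.
move=> x0 wM; apply: normed_cvg => /=.
(* The absolute values are dominated by a multiple of the exponential series. *)
apply: (@series_le_cvg _ _ (fun j => (expR (- x) * M) *: exp_coeff x j)) => //.
- by move=> j; exact: normr_ge0.
- move=> j /=; rewrite mulr_ge0 ?exp_coeff_ge0// mulr_ge0 ?expR_ge0//.
  exact: le_trans (wM 0%N).
- move=> j /=; rewrite normrM ger0_norm ?poisson_weight_ge0//.
  rewrite /poisson_weight /exp_coeff /= [leRHS]mulrAC.
  by rewrite ler_wpM2l// poisson_weight_ge0.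
- exact: is_cvg_seriesZ (is_cvg_series_exp_coeff x).
Qed.

Lemma poisson_mean_cst x c : poisson_mean x (fun=> c) = c.
Proof.
have expE : (fun j => poisson_weight x j * c) = (c * expR (- x)) *: exp_coeff x.
  by apply/funext => j; rewrite /poisson_weight [LHS]mulrC [LHS]mulrA.
rewrite /poisson_mean expE lim_seriesZ; last exact: is_cvg_series_exp_coeff.
by rewrite -/(expR x) /GRing.scale/= -mulrA -expRD addNr expR0 mulr1.
Qed.

Lemma poisson_meanB M x w z : 0 <= x ->
    (forall j, `|w j| <= M) -> (forall j, `|z j| <= M) ->
  poisson_mean x (fun j => w j - z j) = poisson_mean x w - poisson_mean x z.
Proof.
move=> x0 wM zM; rewrite /poisson_mean -lim_seriesB; first last.
- exact: is_cvg_poisson_mean zM.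
- exact: is_cvg_poisson_mean wM.
by congr (limn (series _)); apply/funext => j /=; rewrite mulrBr.
Qed.

Lemma ler_poisson_mean M x w z : 0 <= x ->
    (forall j, `|w j| <= M) -> (forall j, `|z j| <= M) ->
    (forall j, w j <= z j) ->
  poisson_mean x w <= poisson_mean x z.
Proof.
move=> x0 wM zM wz; apply: lim_series_le.
- exact: is_cvg_poisson_mean wM.
- exact: is_cvg_poisson_mean zM.
- by move=> j; rewrite ler_wpM2l// poisson_weight_ge0.
Qed.

Lemma poisson_mean_delta x c k :
  poisson_mean x (fun j => if j == k then c else 0) = poisson_weight x k * c.
Proof.
(* The partial sums are constant as soon as they contain the term of index [k]. *)
apply/cvg_lim => //; apply: cvg_near_cst; near=> n.
rewrite /series/= (bigD1_seq k) ?iota_uniq//=; last first.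
  by rewrite mem_index_iota /=; near: n; exact: nbhs_infty_gt.
rewrite eqxx big1 ?addr0// => j /negbTE ->; exact: mulr0.
Unshelve. all: by end_near. Qed.

(** Every Poisson weight is positive when [x > 0], so the term of index [k] alone is a positive
    lower bound for the mean. *)
Lemma poisson_mean_gt0 M x w k : 0 < x -> (forall j, `|w j| <= M) ->
  (forall j, 0 <= w j) -> 0 < w k -> 0 < poisson_mean x w.
Proof.
move=> x0 wM w0 wk0.
apply: (@lt_le_trans _ _ (poisson_weight x k * w k)).
  by rewrite mulr_gt0// poisson_weight_gt0.
rewrite -poisson_mean_delta; apply: (@ler_poisson_mean M) => //.
- exact: ltW.
- by move=> j; case: eqP => _//; rewrite normr0 (le_trans _ (wM j)).
- by move=> j; case: eqP => [->|].
Qed.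

(* The bound in [x] near [0] is what makes the singularity [t ^ (- 1 - alpha)]
   integrable; the one near infinity is trivial. *)
Lemma norm_poisson_meanB0 M x w : 0 <= x -> (forall j, `|w j| <= M) ->
  `|poisson_mean x w - w 0%N| <= 2 * M * Num.min 1 x.
Proof.
move=> x0 wM.
have M0 : 0 <= M by exact: le_trans (wM 0%N).
(* This majorant of [|w j - w 0|] vanishes at [0], so its mean is [2 M] times the Poisson mass
   [1 - exp (- x)] of the positive integers. That mass is at most both [1] and [x]. *)
pose b (j : nat) := 2 * M - (if j == 0%N then 2 * M else 0).
have Mb : 2 * M <= 2 * (2 * M) by lra.
have M2 : 0 <= 2 * M by lra.
have wB j : `|w j - w 0%N| <= 2 * M.
  by have := wM j; have := wM 0%N; rewrite !ler_norml; lra.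
have deltaB (j : nat) : `|if j == 0%N then 2 * M else 0| <= 2 * M.
  by case: ifP => _; rewrite ?normr0 ?ger0_norm.
have bE : poisson_mean x b = 2 * M * (1 - expR (- x)).
  rewrite /b (@poisson_meanB (2 * M))// ?poisson_mean_cst ?poisson_mean_delta//.
    by rewrite /poisson_weight expr0 fact0 divr1 mulr1; ring.
  by move=> j; rewrite ger0_norm.
have bB j : `|b j| <= 2 * M.
  by rewrite /b; case: ifP; rewrite ?subrr ?subr0 ?normr0 ?ger0_norm.
have wb j : `|w j - w 0%N| <= b j.
  by rewrite /b; case: eqP => [->|_]; rewrite ?subrr ?normr0 ?subr0.
have -> : poisson_mean x w - w 0%N = poisson_mean x (fun j => w j - w 0%N).
  by rewrite (@poisson_meanB M)// poisson_mean_cst.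
apply: (@le_trans _ _ (poisson_mean x b)).
  rewrite ler_norml; apply/andP; split; last first.
    apply: (@ler_poisson_mean (2 * M)) => // j.
    exact: le_trans (ler_norm _) _.
  rewrite lerNl -[leLHS]sub0r -[X in X - _](poisson_mean_cst x).
  rewrite -(@poisson_meanB (2 * M))//; last by rewrite normr0.
  apply: (@ler_poisson_mean (2 * M)) => // j.
    by rewrite sub0r normrN.
  by rewrite sub0r (le_trans _ (wb j))// -normrN ler_norm.
rewrite bE ler_wpM2l// le_min lerBlDr lerDl expR_ge0/=.
by have := expR_ge1Dx (- x); lra.
Qed.

Lemma measurable_poisson_mean M (h : R) w : 0 < h -> (forall j, `|w j| <= M) ->
  measurable_fun (`]0, +oo[ : set R) (fun t : R => poisson_mean (t / h) w).
Proof.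
move=> h0 wM.
refine (@measurable_fun_cvg _ _ R (`]0, +oo[ : set R)
  (fun n t => series (fun j => poisson_weight (t / h) j * w j) n) _ _ _).
  move=> n; apply: measurable_sum => j.
  apply: measurable_funM => //; apply: measurable_funM.
    apply: measurableT_comp => //; apply: measurableT_comp => //.
    exact: measurable_funM.
  apply: measurable_funM => //; apply: measurable_funX.
  exact: measurable_funM.
move=> t /=; rewrite in_itv/= andbT => t0.
apply: (is_cvg_poisson_mean _ wM); exact: divr_ge0 (ltW _) (ltW _).
Qed.

End PoissonMean.

(** * Strict positivity of integrals, and bounds on increasing unions *)

Section PositiveIntegral.
Context d (T : measurableType d) (R : realType).
Context (mu : {measure set T -> \bar R}).

(** If the integral were [0], [f] would vanish almost everywhere on [D]; being positive there, it
    would force [D] to be negligible. *)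
Lemma Rintegral_gt0 (D : set T) (f : T -> R) : measurable D ->
    (0 < mu D)%E -> mu.-integrable D (EFin \o f) ->
    (forall t, D t -> 0 < f t) ->
  0 < \int[mu]_(t in D) f t.
Proof.
move=> mD muD0 intf f0.
rewrite lt0r Rintegral_ge0 ?andbT; last by move=> t /f0 /ltW.
apply/eqP => int0.
have eint0 : (\int[mu]_(t in D) `|(EFin \o f) t|)%E = 0%E.
  transitivity (\int[mu]_(t in D) (EFin \o f) t)%E.
    by apply: eq_integral => t /set_mem/f0 ft0 /=; rewrite gtr0_norm.
  by rewrite -[LHS]fineK ?integrable_fin_num//; congr EFin.
have /(ae_eq_integral_abs mu mD) : measurable_fun D (EFin \o f).
  by case/integrableP : intf.
case=> /(_ eint0) [N [mN muN0 DN]] _.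
move: muD0; rewrite lt0e => /andP[/eqP + _]; apply.
apply: (subset_measure0 mD mN _ muN0) => t Dt; apply: DN => /= /(_ Dt).
by move=> /eqP; rewrite eqe gt_eqF// f0.
Qed.

(** Monotone convergence; it carries bounds from compact intervals over to improper integrals. *)
Lemma ge0_integral_bigcup_le (F : (set T)^nat) (f : T -> \bar R) (C : \bar R) :
    nondecreasing_seq F -> (forall i, measurable (F i)) ->
    measurable_fun setT f -> (forall i t, F i t -> (0 <= f t)%E) ->
    (forall i, (\int[mu]_(t in F i) f t <= C)%E) ->
  (\int[mu]_(t in \bigcup_i F i) f t <= C)%E.
Proof.
move=> ndF mF mf f0 intC.
have cvgF := @ge0_nondecreasing_set_cvg_integral _ _ _ _ _ mu ndF mF
  (fun i => measurable_funTS mf) f0.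
rewrite -(cvg_lim _ cvgF)//; apply: lime_le; first exact: cvgP cvgF.
exact: nearW.
Qed.

End PositiveIntegral.

(** * Integrability of [min 1 t / t ^ (1 + alpha)] on the half-line *)

Section PowerIntegral.
Context {R : realType}.
Notation mu := (@lebesgue_measure R).
Implicit Types a b c : R.

Lemma continuous_powR c (x : R) : 0 < x ->
  {for x, continuous (fun t : R => t `^ c)}.
Proof.
move=> x0; apply: differentiable_continuous; apply/derivable1_diffP.
by apply: derivable_powR; rewrite in_itv/= x0.
Qed.

(** Allowing [c] of either sign covers both uses: [c = 1 - alpha] near [0] and [c = - alpha] near
    infinity. *)
Lemma integral_powR a b c : 0 < a -> a < b -> c != 0 ->
  (\int[mu]_(t in `[a, b]) (t `^ (c - 1))%:E = ((b `^ c - a `^ c) / c)%:E)%E.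
Proof.
move=> a0 ab c0.
have Fd (x : R) : 0 < x ->
    is_derive x 1 (fun t : R => c^-1 * t `^ c) (x `^ (c - 1)).
  move=> x0; have -> : x `^ (c - 1) = c^-1 *: (c * x `^ (c - 1)).
    by rewrite /GRing.scale/= mulKf.
  exact/is_deriveZ/is_derive1_powR.
have Fc (x : R) : 0 < x -> {for x, continuous (fun t : R => c^-1 * t `^ c)}.
  move=> x0; apply: differentiable_continuous; apply/derivable1_diffP.
  by apply: ex_derive; exact: Fd.
rewrite (@continuous_FTC2 _ _ (fun t => c^-1 * t `^ c))//.
- by rewrite -EFinB; congr EFin; rewrite [RHS]mulrC mulrBr.
- apply: continuous_in_subspaceT => x /set_mem/=.
  rewrite in_itv/= => /andP[ax _].
  by apply: continuous_powR; exact: lt_le_trans ax.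
- split.
  + move=> x; rewrite in_itv/= => /andP[ax _].
    by apply: ex_derive; apply: Fd; exact: lt_trans ax.
  + by apply: cvg_at_right_filter; exact: Fc.
  + by apply: cvg_at_left_filter; apply: Fc; exact: lt_trans ab.
- move=> x; rewrite in_itv/= => /andP[ax _].
  by rewrite derive1E; apply: derive_val; apply: Fd; exact: lt_trans ax.
Qed.

Let measurable_powR_EFin c : measurable_fun setT (fun t : R => (t `^ c)%:E).
Proof. by apply/measurable_EFinP; exact: measurable_powR. Qed.

Lemma integral_powR_near0 c : 0 < c ->
  (\int[mu]_(t in `]0%R, 1%R]) (t `^ (c - 1))%:E <= (c^-1)%:E)%E.
Proof.
move=> c0.
(* Starting at [1 / 2] keeps every interval nondegenerate, as [integral_powR] demands. *)
have -> : `]0, 1]%classic = \bigcup_n `[(n.+2%:R : R)^-1, 1]%classic.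
  apply/seteqP; split => [t|t [n _]] /=; rewrite !in_itv/= => /andP[t0 t1].
    exists (Num.Def.archi_bound t^-1) => //=; rewrite in_itv/= t1 andbT.
    rewrite invf_ple ?posrE ?ltr0n//.
    rewrite (le_trans (ltW (archi_boundP _)))// ?invr_ge0 ?(ltW t0)//.
    by rewrite ler_nat ltnW.
  by rewrite t1 andbT (lt_le_trans _ t0)// invr_gt0 ltr0n.
apply: ge0_integral_bigcup_le => //.
- move=> m n mn; apply/subsetPset => t /=; rewrite !in_itv/= => /andP[+ ->].
  by rewrite andbT; apply: le_trans; rewrite lef_pV2 ?posrE ?ltr0n// ler_nat.
- exact: measurable_powR_EFin.
- by move=> i t _; rewrite lee_fin powR_ge0.
- move=> i; rewrite integral_powR ?gt_eqF ?invr_gt0 ?ltr0n//; last first.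
    by rewrite invf_lt1 ?ltr0n// ltr1n.
  by rewrite lee_fin powR1 ler_pdivrMr// mulVf ?gt_eqF// gerBl powR_ge0.
Qed.

Lemma integral_powR_near_pinfty c : 0 < c ->
  (\int[mu]_(t in `[1%R, +oo[) (t `^ (- c - 1))%:E <= (c^-1)%:E)%E.
Proof.
move=> c0.
have -> : `[1, +oo[%classic = \bigcup_n `[1, (n.+2%:R : R)]%classic.
  apply/seteqP; split => [t|t [n _]] /=; rewrite !in_itv/=; last first.
    by case/andP => ->.
  rewrite andbT => t1; exists (Num.Def.archi_bound t) => //=.
  rewrite in_itv/= t1/= (le_trans (ltW (archi_boundP _)))//.
    exact: le_trans t1.
  by rewrite ler_nat ltnW.
apply: ge0_integral_bigcup_le => //.
- move=> m n mn; apply/subsetPset => t /=; rewrite !in_itv/= => /andP[-> +] /=.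
  by move=> /le_trans; apply; rewrite ler_nat.
- exact: measurable_powR_EFin.
- by move=> i t _; rewrite lee_fin powR_ge0.
- move=> i; rewrite integral_powR ?oppr_eq0 ?gt_eqF ?ltr1n//.
  rewrite lee_fin powR1 invrN mulrN -mulNr opprB ler_pdivrMr// mulVf ?gt_eqF//.
Qed.

(** The integrand is [t ^ (- alpha)] up to [1] and [t ^ (- 1 - alpha)] beyond. The two pieces
    contribute at most [1 / (1 - alpha)] and [1 / alpha], whence both bounds on [alpha]. *)
Lemma integrable_min_powR (alpha : R) : 0 < alpha < 1 ->
  mu.-integrable `]0, +oo[
    (EFin \o (fun t => Num.min 1 t / t `^ (1 + alpha))).
Proof.
move=> /andP[a0 a1].
have mk : measurable_fun setT
    (EFin \o (fun t : R => Num.min 1 t / t `^ (1 + alpha))).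
  apply/measurable_EFinP; apply: measurable_funM.
    by apply: measurable_minr.
  rewrite (_ : (fun x => _) = (fun t : R => t `^ (- (1 + alpha)))); last first.
    by apply/funext => t; rewrite powRN.
  exact: measurable_powR.
have mnk : measurable_fun setT
    (fun t : R => `|Num.min 1 t / t `^ (1 + alpha)|%:E).
  by apply/measurable_EFinP/measurableT_comp => //; exact/measurable_EFinP.
apply/integrableP; split; first exact: measurable_funTS.
have -> : `]0, +oo[%classic = `]0%R, 1%R] `|` `]1%R, +oo[ :> set R.
  by apply: itv_bndbnd_setU; rewrite bnd_simp ?ler01.
have ge0 t : 0 < t -> 0 <= Num.min 1 t / t `^ (1 + alpha).
  by move=> t0; rewrite divr_ge0 ?powR_ge0// le_min ler01 ltW.
rewrite ge0_integral_setU//=; last 2 first.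
- exact: measurable_funTS mnk.
- apply/disj_set2P; rewrite -subset0 => t [] /=.
  rewrite !in_itv/= andbT => /andP[_ +] => /le_lt_trans /[apply].
  by rewrite ltxx.
apply: lte_add_pinfty.
  apply: (@le_lt_trans _ _ ((1 - alpha)^-1)%:E); last exact: ltry.
  apply: le_trans (integral_powR_near0 _); last by rewrite subr_gt0.
  rewrite le_eqVlt; apply/orP; left; apply/eqP; apply: eq_integral => t.
  move=> /set_mem/=; rewrite in_itv/= => /andP[t0 t1].
  rewrite ger0_norm ?ge0//; congr EFin; rewrite min_r//.
  rewrite -[X in X / _]powRr1 ?ltW// -powRB ?(gt_eqF t0) ?implybT//.
  by congr (_ `^ _); ring.
apply: (@le_lt_trans _ _ (alpha^-1)%:E); last exact: ltry.
apply: le_trans (integral_powR_near_pinfty a0).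
rewrite integral_itv_obnd_cbnd; last first.
  exact: measurable_funTS mnk.
rewrite le_eqVlt; apply/orP; left; apply/eqP; apply: eq_integral => t.
move=> /set_mem/=; rewrite in_itv/= andbT => t1.
have t0 : 0 < t by exact: lt_le_trans t1.
rewrite ger0_norm ?ge0//; congr EFin; rewrite min_l// div1r -powRN.
by congr (_ `^ _); ring.
Qed.

End PowerIntegral.

(** * Integrability of the integrand of the fractional derivative, and the sign of
    [Gamma (- alpha)] *)

Lemma le_integrable_min_powR (R : realType) (alpha C : R) (f : R -> R) :
    0 < alpha < 1 ->
    measurable_fun (`]0, +oo[ : set R) f ->
    (forall t, 0 < t -> `|f t| <= C * (Num.min 1 t / t `^ (1 + alpha))) ->
  (@lebesgue_measure R).-integrable `]0, +oo[ (EFin \o f).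
Proof.
move=> alpha01 mf fC.
have iC : (@lebesgue_measure R).-integrable `]0, +oo[
    (fun t => C%:E * (Num.min 1 t / t `^ (1 + alpha))%:E)%E.
  by apply: integrableZl => //; exact: integrable_min_powR.
apply: le_integrable iC => //.
- exact/measurable_EFinP.
- move=> t /=; rewrite in_itv/= andbT => t0; rewrite lee_fin.
  by apply: le_trans (ler_norm _); exact: fC.
Qed.

Lemma integrable_poisson_quotient (R : realType) (h alpha M : R)
    (w : nat -> R) :
    0 < h -> 0 < alpha < 1 -> (forall j, `|w j| <= M) ->
  (@lebesgue_measure R).-integrable `]0, +oo[
    (EFin \o (fun t => (poisson_mean (t / h) w - w 0%N) / t `^ (1 + alpha))).
Proof.
move=> h0 alpha01 wM.
have M0 : 0 <= M by exact: le_trans (wM 0%N).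
(* The factor [1 + 1 / h] absorbs the change of scale: [min 1 (t / h) <= (1 + 1 / h) * min 1 t]. *)
apply: (@le_integrable_min_powR _ alpha (2 * M * (1 + h^-1))) => //.
  apply: measurable_funM.
    by apply: measurable_funB => //; exact: measurable_poisson_mean wM.
  apply: measurable_funTS.
  rewrite (_ : (fun x => _) = (fun t : R => t `^ (- (1 + alpha)))); last first.
    by apply/funext => t; rewrite powRN.
  exact: measurable_powR.
move=> t t0; have th0 : 0 <= t / h by rewrite divr_ge0// ltW.
rewrite normrM normfV (ger0_norm (powR_ge0 _ _)) mulrA ler_wpM2r//.
  by rewrite invr_ge0 powR_ge0.
apply: le_trans (norm_poisson_meanB0 th0 wM) _.
rewrite -[leRHS]mulrA ler_wpM2l//.
  by rewrite mulr_ge0.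
rewrite mulrDl mul1r [h^-1 * _]mulrC.
have [t1|t1] := leP 1 t.
  by rewrite ge_min mul1r lerDl invr_ge0 ltW.
by rewrite ge_min lerDr (ltW t0) orbT.
Qed.

(** On this interval [Gamma s = Gamma (s + 1) / s], with a positive numerator. Integrability must be
    checked first, since an infinite integral would be read as [0] in [R]. *)
Lemma Gamma_lt0 (R : realType) (s : R) : -1 < s < 0 -> Gamma s < 0.
Proof.
move=> /andP[s1 s0].
have gamma0 : 0 < euler_gamma (s + 1).
  have intg : (@lebesgue_measure R).-integrable `]0, +oo[
      (EFin \o (fun t => t `^ (s + 1 - 1) * expR (- t))).
    apply: (@le_integrable_min_powR _ (- s) 1); first by lra.
      apply: measurable_funM.
        by apply: measurable_funTS; exact: measurable_powR.
      by apply: measurableT_comp => //; exact: measurableT_comp.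
    move=> t t0; rewrite mul1r addrK ger0_norm; last first.
      by rewrite mulr_ge0 ?powR_ge0 ?expR_ge0.
    have -> : t `^ s = t / t `^ (1 - s).
      rewrite -[X in X / _](powRr1 (ltW t0)) -powRB ?(gt_eqF t0) ?implybT//.
      by congr (_ `^ _); ring.
    rewrite mulrAC ler_wpM2r ?invr_ge0 ?powR_ge0// le_min.
    have := expR_ge1Dx t; have := expR_gt0 t; rewrite expRN => e0 te.
    rewrite ler_pdivrMr// mul1r ler_pdivrMr// ler_peMr ?(ltW t0)//; lra.
  apply: Rintegral_gt0 intg _ => //=.
    by rewrite lebesgue_measure_itv/= ltry sube0.
  move=> t; rewrite in_itv/= andbT => t0.
  by rewrite mulr_gt0 ?powR_gt0 ?expR_gt0.
rewrite /Gamma (lt_gtF s0)/=.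
(* As [0 < - s < 1], the continuation takes one step and its product has the single factor [s]. *)
have -> : Num.truncn (- s) = 0%N by apply/truncn0Pn; rewrite -ltNge; lra.
by rewrite big_ord1 addr0 pmulr_rlt0// invr_lt0.
Qed.

(** * The comparison principle for bounded functions *)

Section Comparison.
Context {R : realType} (h alpha : R) (h0 : 0 < h) (alpha01 : 0 < alpha < 1).
Implicit Types (M : R) (u v : mesh h -> R) (j n m : int).

Lemma ltr_frac_delta_right (M : R) u v n m :
    (forall x, `|u x| <= M) -> (forall x, `|v x| <= M) ->
    (forall j, n <= j ->
      u (node h n) - v (node h n) <= u (node h j) - v (node h j)) ->
    n <= m ->
    u (node h n) - v (node h n) < u (node h m) - v (node h m) ->
  frac_delta_right alpha u n < frac_delta_right alpha v n.
Proof.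
move=> uM vM min_n nm lt_nm.
pose at_n (f : mesh h -> R) (i : nat) := f (node h (n + i%:Z)).
have at0 f : at_n f 0%N = f (node h n) by rewrite /at_n addr0.
have M0 : 0 <= M by exact: le_trans (uM (node h n)).
have wM f : (forall x, `|f x| <= M) -> forall i, `|at_n f i| <= M.
  by move=> fM i; exact: fM.
(* The negative factor [1 / Gamma (- alpha)] reverses the inequality: the integral for [u] has to be
   the larger one. *)
rewrite /frac_delta_right ltr_nM2l ?invr_lt0; last first.
  by apply: Gamma_lt0; rewrite ltrN2 oppr_lt0 andbC.
have intu := integrable_poisson_quotient h0 alpha01 (wM _ uM).
have intv := integrable_poisson_quotient h0 alpha01 (wM _ vM).
rewrite !at0 in intu intv.
rewrite -subr_gt0 -RintegralB//; apply: Rintegral_gt0 => //=.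
- by rewrite lebesgue_measure_itv/= ltry sube0.
- exact: integrableB intu intv.
move=> t; rewrite in_itv/= andbT => t0; rewrite -mulrBl divr_gt0 ?powR_gt0//.
have th0 : 0 < t / h by rewrite divr_gt0.
rewrite -![right_semigroup _ _ _]/(poisson_mean (t / h) (at_n _)).
set x := t / h.
pose c : R := u (node h n) - v (node h n).
have diffM i : `|at_n u i - at_n v i| <= 2 * M.
  by have := wM _ uM i; have := wM _ vM i; rewrite !ler_norml; lra.
have cM : `|c| <= 2 * M by have := diffM 0%N; rewrite !at0.
(* Subtracting the value [c] at [n] leaves a nonnegative sequence, positive at the index [m - n]. *)
suff : 0 < poisson_mean x (fun i => at_n u i - at_n v i - c).
  rewrite (@poisson_meanB _ (2 * M)) ?(ltW th0)//.
  rewrite (@poisson_meanB _ M) ?(ltW th0)//; try exact: wM.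
  rewrite poisson_mean_cst /c /poisson_mean /right_semigroup /poisson_weight.
  by rewrite /at_n; lra.
have mE : m = n + `|m - n|%N%:Z.
  by rewrite gez0_abs ?subr_ge0// [RHS]addrC subrK.
apply: (@poisson_mean_gt0 _ (4 * M) _ _ `|m - n|%N) => //.
- move=> i; have := diffM i; move: cM; rewrite !ler_norml; lra.
- by move=> i; rewrite subr_ge0; apply: min_n; rewrite lerDl.
- by rewrite subr_gt0 /at_n -mE.
Qed.

Lemma frac_delta_right_le (M : R) u v (j0 j1 : int) :
    (forall x, `|u x| <= M) -> (forall x, `|v x| <= M) ->
    (forall j, j0 <= j < j1 ->
      frac_delta_right alpha v j <= frac_delta_right alpha u j) ->
    (forall j, j1 <= j -> v (node h j) <= u (node h j)) ->
  forall j, j0 <= j -> v (node h j) <= u (node h j).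
Proof.
move=> uM vM delta_le vu j j0j; rewrite leNgt; apply/negP => uvj.
have jj1 : j < j1.
  by rewrite ltNge; apply/negP => /vu; rewrite leNgt uvj.
pose N := `|j1 - j0|%N.
have NE : N%:Z = j1 - j0.
  by rewrite gez0_abs// subr_ge0 ltW// (le_lt_trans j0j).
pose w i := u (node h i) - v (node h i).
(* Indexing the window by the finite type ['I_N] gives access to a minimum of [w] over it. *)
have idx i : j0 <= i < j1 -> exists k : 'I_N, i = j0 + k%:Z.
  move=> /andP[ji ij].
  have iN : (`|i - j0| < N)%N.
    by rewrite -ltz_nat NE gez0_abs ?subr_ge0// ltrD2r.
  by exists (Ordinal iN); rewrite /= gez0_abs ?subr_ge0// [RHS]addrC subrK.
have [k0 jE] : exists k : 'I_N, j = j0 + k%:Z by apply: idx; rewrite j0j.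
pose k := [arg min_(i < k0) w (j0 + i%:Z)]%O.
have k_min (i : 'I_N) : w (j0 + k%:Z) <= w (j0 + i%:Z).
  by rewrite /k; case: Order.TotalTheory.arg_minP => // i0 _; exact.
pose n := j0 + k%:Z.
have nj1 : n < j1 by rewrite /n addrC -ltrBrDr -NE ltz_nat.
have n_in : j0 <= n < j1 by rewrite nj1 lerDl.
have wn0 : w n < 0 by rewrite (le_lt_trans (k_min k0))// -jE subr_lt0.
(* The minimum over the window remains one over [[n, oo[], because [w n < 0 <= w i] for
   [i >= j1]. *)
have n_min i : n <= i -> w n <= w i.
  move=> ni; have [ij1|j1i] := ltP i j1.
    have [|i' ->] := idx i; last exact: k_min.
    by rewrite ij1 andbT (le_trans _ ni)// lerDl.
  by rewrite (le_trans (ltW wn0))// subr_ge0; exact: vu.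
suff : frac_delta_right alpha u n < frac_delta_right alpha v n.
  by rewrite ltNge delta_le.
(* The later point with a strictly larger difference is [j1], where [w] is nonnegative. *)
apply: (ltr_frac_delta_right uM vM n_min (ltW nj1)).
by rewrite (lt_le_trans wn0)// subr_ge0; exact: vu.
Qed.

End Comparison.

(** * From [ell p] to bounded functions, and the theorem *)

Lemma ell_bounded (R : realType) (h : R) (p : \bar R) (u : mesh h -> R) :
  (1 <= p)%E -> ell p u -> exists M, forall x, `|u x| <= M.
Proof.
case: p => [r||]//; rewrite lee_fin => r1 /= su.
have sfin : (\esum_(x in [set: mesh h]) `|(`|u x| `^ r)%:E| \is a fin_num)%E.
  by rewrite -summableE.
(* Each [|u x| ^ r] is at most the sum. If [|u x| >= 1], then [|u x| <= |u x| ^ r] because [r >= 1];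
   otherwise the summand [1] suffices. *)
exists (1 + fine (\esum_(x in [set: mesh h]) `|(`|u x| `^ r)%:E|)%E) => x.
have : `|u x| `^ r <= fine (\esum_(x in [set: mesh h]) `|(`|u x| `^ r)%:E|)%E.
  rewrite -lee_fin fineK//; apply: esum_ge; exists [set x].
    by split.
  by rewrite fsbig_set1 /= lee_fin ler_norm.
have [u1|/ltW u1] := leP 1 `|u x|.
  by move=> /(le_trans (le1r_powR u1 r1)) /le_trans; apply; rewrite lerDr.
have := powR_ge0 `|u x| r; lra.
Qed.

Lemma frac_delta_right_cst (R : realType) (h alpha c : R) (n : int) :
  frac_delta_right alpha (fun _ : mesh h => c) n = 0.
Proof.
rewrite /frac_delta_right /Rintegral integral0_eq ?mulr0// => t _.
rewrite [right_semigroup _ _ _](poisson_mean_cst (t / h) c).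
by rewrite subrr mul0r.
Qed.

Theorem theorem2 (R : realType) (h alpha : R) (p : \bar R) (j0 j1 : int)
    (u v : mesh h -> R)
    (h_gt0 : 0 < h) (alpha_gt0 : 0 < alpha) (alpha_lt1 : alpha < 1)
    (p_ge1 : (1 <= p)%E) (j0_lt_j1 : j0 < j1)
    (u_ellp : ell p u) (v_ellp : ell p v) :
  (* (i) *)
  (forall f : mesh h -> R,
     dirichlet_solution alpha j0 j1 f (fun=> 0) u ->
     (forall j : int, j0 <= j < j1 -> 0 <= f (node h j)) ->
     forall j : int, j0 <= j -> 0 <= u (node h j)) /\
  (* (ii) *)
  ((forall j : int, j0 <= j < j1 -> frac_delta_right alpha u j <= 0) ->
   (forall j : int, j1 <= j -> u (node h j) <= 0) ->
   ereal_sup [set (u (node h j))%:E | j in [set j : int | j0 <= j]] =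
   ereal_sup [set (u (node h j))%:E | j in [set j : int | j1 <= j]]) /\
  (* (iii) *)
  ((forall j : int, j0 <= j < j1 -> 0 <= frac_delta_right alpha u j) ->
   (forall j : int, j1 <= j -> 0 <= u (node h j)) ->
   ereal_inf [set (u (node h j))%:E | j in [set j : int | j0 <= j]] =
   ereal_inf [set (u (node h j))%:E | j in [set j : int | j1 <= j]]) /\
  (* (iv) *)
  ((forall j : int, j0 <= j < j1 ->
      frac_delta_right alpha v j <= frac_delta_right alpha u j) ->
   (forall j : int, j1 <= j -> v (node h j) <= u (node h j)) ->
   forall j : int, j0 <= j -> v (node h j) <= u (node h j)) /\
  (forall f g : mesh h -> R,
     dirichlet_solution alpha j0 j1 f g u ->
     dirichlet_solution alpha j0 j1 f g v ->
     forall j : int, j0 <= j -> u (node h j) = v (node h j)).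
Proof.
have alpha01 : 0 < alpha < 1 by rewrite alpha_gt0.
have [Mu uMu] := ell_bounded p_ge1 u_ellp.
have [Mv vMv] := ell_bounded p_ge1 v_ellp.
(* A separate bound for each function is more convenient here, one of the two being often a
   constant; their maximum serves for both. *)
have comparison (f g : mesh h -> R) :
    (exists M, forall x, `|f x| <= M) -> (exists M, forall x, `|g x| <= M) ->
    (forall j : int, j0 <= j < j1 ->
      frac_delta_right alpha g j <= frac_delta_right alpha f j) ->
    (forall j : int, j1 <= j -> g (node h j) <= f (node h j)) ->
    forall j : int, j0 <= j -> g (node h j) <= f (node h j).
  move=> [Mf fM] [Mg gM].
  apply: (@frac_delta_right_le _ _ _ _ _ (Num.max Mf Mg)) => // x.
    by rewrite le_max fM.
  by rewrite le_max gM orbT.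
have cst_bounded (c : R) : exists M, forall x : mesh h, `|c| <= M.
  by exists `|c|.
have u_bounded : exists M, forall x, `|u x| <= M by exists Mu.
have v_bounded : exists M, forall x, `|v x| <= M by exists Mv.
have sub_half : [set j : int | j1 <= j] `<=` [set j | j0 <= j].
  by move=> j /=; apply: le_trans; exact: ltW.
split; [|split; [|split; [|split]]].
- move=> f [uf u0] f0; apply: (comparison u (fun=> 0)) => //.
    by move=> j jj; rewrite frac_delta_right_cst uf// f0.
  by move=> j /u0 ->.
- move=> u_le _; apply/eqP; rewrite eq_le; apply/andP; split; last first.
    by apply: ereal_sup_le => _ [j /sub_half j0j <-]; exists j.
  set S := ereal_sup [set (u (node h j))%:E | j in [set j | j1 <= j]].
  have leS (j : int) : j1 <= j -> ((u (node h j))%:E <= S)%E.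
    by move=> j1j; apply: ereal_sup_ubound; exists j.
  (* The value at [j1] bounds [S] from below and [Mu] bounds it from above, so [S] can be used as a
     real constant function. *)
  have Sfin : S \is a fin_num.
    rewrite fin_numE -ltey -ltNye (lt_le_trans (ltNyr _) (leS j1 (lexx _)))/=.
    apply: (@le_lt_trans _ _ Mu%:E); last exact: ltry.
    apply: ge_ereal_sup => _ [j _ <-]; rewrite lee_fin.
    exact: le_trans (ler_norm _) (uMu _).
  apply: ge_ereal_sup => _ [j j0j <-]; rewrite -(fineK Sfin) lee_fin.
  (* The constant dominates [u] on [[j1, oo[] by the choice of [S], and its fractional derivative
     [0] dominates that of [u] on the window. *)
  apply: (comparison (fun=> fine S) u) => // i.
    by move=> ii; rewrite frac_delta_right_cst u_le.
  by move=> j1i; rewrite -lee_fin fineK// leS.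
- move=> u_ge _; apply/eqP; rewrite eq_le; apply/andP; split.
    by apply: ereal_inf_le_tmp => _ [j /sub_half j0j <-]; exists j.
  set S := ereal_inf [set (u (node h j))%:E | j in [set j | j1 <= j]].
  have geS (j : int) : j1 <= j -> (S <= (u (node h j))%:E)%E.
    by move=> j1j; apply: ereal_inf_lbound; exists j.
  have Sfin : S \is a fin_num.
    rewrite fin_numE -ltey -ltNye.
    rewrite (le_lt_trans (geS j1 (lexx _)) (ltry _)) andbT.
    apply: (@lt_le_trans _ _ (- Mu)%:E); first exact: ltNyr.
    apply: le_ereal_inf_tmp => _ [j _ <-]; rewrite lee_fin lerNl.
    by rewrite (le_trans _ (uMu (node h j)))// -normrN ler_norm.
  apply: le_ereal_inf_tmp => _ [j j0j <-]; rewrite -(fineK Sfin) lee_fin.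
  apply: (comparison u (fun=> fine S)) => // i.
    by move=> ii; rewrite frac_delta_right_cst u_ge.
  by move=> j1i; rewrite -lee_fin fineK// geS.
- exact: comparison.
(* Two solutions share their fractional derivative on the window and their values beyond it, so the
   comparison applies in both directions. *)
- move=> f g [uf ug] [vf vg] j j0j; apply/eqP; rewrite eq_le; apply/andP; split.
    apply: (comparison v u) => // i ii; first by rewrite uf// vf.
    by rewrite ug// vg.
  apply: (comparison u v) => // i ii; first by rewrite uf// vf.
  by rewrite ug// vg.
Qed.
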